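(* Let $f=[g:g_1,\dots,g_s;h_1,\dots,h_r]$ be a differentiable convertible nonconvex function. (i) If $L(\boldsymbol{x}^*,\boldsymbol{y}^*;\boldsymbol{u}^*,\boldsymbol{v}^* )=\theta(\boldsymbol{u}^*,\boldsymbol{v}^* )$ at $(\boldsymbol{x}^*,\boldsymbol{y}^* )\in R^n\times R^m$ and $(\boldsymbol{u}^*,\boldsymbol{v}^* )\in R^s_+\times R^r$, then $$\nabla L(\boldsymbol{x}^*,\boldsymbol{y}^*;\boldsymbol{u}^*,\boldsymbol{v}^* )=\nabla g(\boldsymbol{x}^*,\boldsymbol{y}^* )+\sum_{i=1}^s u_i^*\nabla g_i(\boldsymbol{x}^*,\boldsymbol{y}^* )+\sum_{j=1}^r v_j^*\nabla h_j(\boldsymbol{x}^*,\boldsymbol{y}^* )=0.$$ (ii) If $g(\boldsymbol{x}^*,\boldsymbol{y}^* )=\theta(\boldsymbol{u}^*,\boldsymbol{v}^* )$ at $(\boldsymbol{x}^*,\boldsymbol{y}^* )\in X(g)$ and $(\boldsymbol{u}^*,\boldsymbol{v}^* )\in R^s_+\times R^r$, then $\nabla L(\boldsymbol{x}^*,\boldsymbol{y}^*;\boldsymbol{u}^*,\boldsymbol{v}^* )=0$ and $u_i^*g_i(\boldsymbol{x}^*,\boldsymbol{y}^* )=0$ for $i=1,\dots,s$, $(\boldsymbol{x}^*,\boldsymbol{y}^* )$ is an optimal solution to (CNP), and $(\boldsymbol{u}^*,\boldsymbol{v}^* )$ is an optimal solution to (DCNP). (iii) Let $(\boldsymbol{x}^*,\boldsymbol{y}^*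 )\in R^n\times R^m$ and $(\boldsymbol{u}^*,\boldsymbol{v}^* )\in R^s_+\times R^r_+$. Then $$\nabla L_+(\boldsymbol{x}^*,\boldsymbol{y}^*;\boldsymbol{u}^*,\boldsymbol{v}^* )=\nabla g(\boldsymbol{x}^*,\boldsymbol{y}^* )+\sum_{i=1}^s u_i^*\nabla g_i(\boldsymbol{x}^*,\boldsymbol{y}^* )+\sum_{j=1}^r v_j^*\nabla h_j(\boldsymbol{x}^*,\boldsymbol{y}^* )=0$$ holds if and only if $L_+(\boldsymbol{x}^*,\boldsymbol{y}^*;\boldsymbol{u}^*,\boldsymbol{v}^* )=\theta_+(\boldsymbol{u}^*,\boldsymbol{v}^* )$. (iv) Let $(\boldsymbol{x}^*,\boldsymbol{y}^* )\in X(f)$ and $(\boldsymbol{u}^*,\boldsymbol{v}^* )\in R^s_+\times R^r_+$. Then $\nabla L_+(\boldsymbol{x}^*,\boldsymbol{y}^*;\boldsymbol{u}^*,\boldsymbol{v}^* )=0$ and $u_i^*g_i(\boldsymbol{x}^*,\boldsymbol{y}^* )=0$ ($i=1,\dots,s$) both hold if and only if $g(\boldsymbol{x}^*,\boldsymbol{y}^* )=\theta_+(\boldsymbol{u}^*,\boldsymbol{v}^* )$. Furthermore, in this case, $(\boldsymbol{x}^*,\boldsymbol{y}^* )$ is an optimal solution to (CNP) and $(\boldsymbol{u}^*,\boldsymbol{v}^* )$ is an optimal solution to (PDCNP).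
   Context: Let $f:R^n\to R$ be nonconvex or nonsmooth and let $g,g_i,h_j:R^n\times R^m\to R$ ($i=1,\dots,s$; $j=1,\dots,r$) be convex. Put $X(f)=\{(\boldsymbol{x},\boldsymbol{y}): g_i(\boldsymbol{x},\boldsymbol{y})\le 0\ (i=1,\dots,s),\ h_j(\boldsymbol{x},\boldsymbol{y})=0\ (j=1,\dots,r)\}$, $X(f(\boldsymbol{x}))=\{\boldsymbol{y}\in R^m: (\boldsymbol{x},\boldsymbol{y})\in X(f)\}$ for fixed $\boldsymbol{x}$, and $X(g)=\{(\boldsymbol{x},\boldsymbol{y})\in X(f): g(\boldsymbol{x},\boldsymbol{y})=f(\boldsymbol{x})\}$. The function $f$ is a convertible nonconvex function, written $f=[g:g_1,\dots,g_s;h_1,\dots,h_r]$, if for each $\boldsymbol{x}\in R^n$ there is $\bar{\boldsymbol{y}}\in X(f(\boldsymbol{x}))$ with $f(\boldsymbol{x})=g(\boldsymbol{x},\bar{\boldsymbol{y}})$ and $f(\boldsymbol{x})=\min_{\boldsymbol{y}\in X(f(\boldsymbol{x}))}g(\boldsymbol{x},\boldsymbol{y})$. It is a differentiable convertible nonconvex function if moreover all of $g,g_i,h_j$ are differentiable (with $s>0$); $f$ itself need not be differentiable or convex. (CNP) is the problem: minimize $g(\boldsymbol{x},\boldsymbol{y})$ subject to $(\boldsymbol{x},\boldsymbol{y})\in X(f)$. Optimal solution means global optimal solution. Gradients are with respect to $(\boldsymbol{x},\boldsymbol{y})$. $R^s_+=\{\boldsymbol{u}\in R^s:\boldsymbol{u}\ge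 0\}$, and similarly $R^r_+$. For $(\boldsymbol{u},\boldsymbol{v})\in R^s_+\times R^r$ let $L(\boldsymbol{x},\boldsymbol{y};\boldsymbol{u},\boldsymbol{v})=g(\boldsymbol{x},\boldsymbol{y})+\sum_{i=1}^s u_ig_i(\boldsymbol{x},\boldsymbol{y})+\sum_{j=1}^r v_jh_j(\boldsymbol{x},\boldsymbol{y})$ and $\theta(\boldsymbol{u},\boldsymbol{v})=\min\{L(\boldsymbol{x},\boldsymbol{y};\boldsymbol{u},\boldsymbol{v}):(\boldsymbol{x},\boldsymbol{y})\in R^n\times R^m\}$. The functions $L_+$ and $\theta_+$ are given by the same formulas but with $(\boldsymbol{u},\boldsymbol{v})$ restricted to $R^s_+\times R^r_+$. The minimum is understood as an infimum, with value $-\infty$ allowed. (DCNP) is the problem: maximize $\theta(\boldsymbol{u},\boldsymbol{v})$ over $R^s_+\times R^r$. (PDCNP) is the problem: maximize $\theta_+(\boldsymbol{u},\boldsymbol{v})$ over $R^s_+\times R^r_+$. *)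

(* Defs.v *)
From HB Require Import structures.
From mathcomp Require Import all_boot all_order all_algebra.
From mathcomp Require Import all_classical all_reals all_analysis.

Set Implicit Arguments.
Unset Strict Implicit.
Unset Printing Implicit Defensive.

Import Order.TTheory GRing.Theory Num.Theory.
Import numFieldNormedType.Exports.

Local Open Scope classical_set_scope.
Local Open Scope ring_scope.

Definition is_minimum (d : Order.disp_t) (S : porderType d) (A : set S) (a : S) :
  Prop := A a /\ lbound A a.

Definition optimal_min (T : Type) (d : Order.disp_t) (S : porderType d)
    (F : T -> S) (X : set T) (z : T) : Prop :=
  X z /\ forall z', X z' -> (F z <= F z')%O.

Definition optimal_max (T : Type) (d : Order.disp_t) (S : porderType d)
    (F : T -> S) (X : set T) (z : T) : Prop :=
  X z /\ forall z', X z' -> (F z' <= F z)%O.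

Definition nonneg_orthant (R : realType) (k : nat) : set 'rV[R]_k :=
  [set u | forall i, 0 <= u 0 i].

Definition gradient (R : realType) (n m : nat)
    (F : 'rV[R]_n * 'rV[R]_m -> R) (z : 'rV[R]_n * 'rV[R]_m) :
    'rV[R]_n * 'rV[R]_m :=
  (\row_i 'D_((delta_mx 0 i, 0) : 'rV[R]_n * 'rV[R]_m) F z,
   \row_j 'D_((0, delta_mx 0 j) : 'rV[R]_n * 'rV[R]_m) F z).

Section ConvertibleFunction.
Context {R : realType} {n m s r : nat}.
Implicit Types (f : 'rV[R]_n -> R) (g : 'rV[R]_n * 'rV[R]_m -> R).
Implicit Types (gs : 'I_s -> 'rV[R]_n * 'rV[R]_m -> R).
Implicit Types (hs : 'I_r -> 'rV[R]_n * 'rV[R]_m -> R).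

(* "Nonsmooth" means failing to be differentiable at some point; for a convex
   function on R^n this is the same as failing to be continuously
   differentiable. *)
Definition nonconvex_or_nonsmooth f : Prop :=
  ~ convex_function [set: 'rV[R]_n] f \/
  ~ (forall x, differentiable f x).

(* X(f) *)
Definition feasible gs hs : set ('rV[R]_n * 'rV[R]_m) :=
  [set z | (forall i, gs i z <= 0) /\ (forall j, hs j z = 0)].

(* X(f(x)) *)
Definition feasible_at gs hs (x : 'rV[R]_n) : set 'rV[R]_m :=
  [set y | feasible gs hs (x, y)].

(* X(g) *)
Definition feasible_tight f g gs hs : set ('rV[R]_n * 'rV[R]_m) :=
  [set z | feasible gs hs z /\ g z = f z.1].

(* f = [g : g_1, ..., g_s; h_1, ..., h_r] *)
Record convertible f g gs hs : Prop := {
  convertible_f : nonconvex_or_nonsmooth f;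
  convertible_g_convex : convex_function [set: 'rV[R]_n * 'rV[R]_m] g;
  convertible_gs_convex :
    forall i, convex_function [set: 'rV[R]_n * 'rV[R]_m] (gs i);
  convertible_hs_convex :
    forall j, convex_function [set: 'rV[R]_n * 'rV[R]_m] (hs j);
  convertible_attained :
    forall x, exists2 y, feasible_at gs hs x y & f x = g (x, y);
  convertible_min :
    forall x, is_minimum [set g (x, y) | y in feasible_at gs hs x] (f x) }.

Record differentiable_convertible f g gs hs : Prop := {
  diff_convertible : convertible f g gs hs;
  diff_convertible_s : (0 < s)%N;
  diff_convertible_g : forall z, differentiable g z;
  diff_convertible_gs : forall i z, differentiable (gs i) z;
  diff_convertible_hs : forall j z, differentiable (hs j) z }.

(* Serves both as L and as L_+, and [dual_fun] both as theta and as theta_+: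
   they differ only in the domain over which the multipliers w = (u, v) range,
   [dual_dom] or [dual_dom_plus]. *)
Definition lagrangian g gs hs (w : 'rV[R]_s * 'rV[R]_r)
    (z : 'rV[R]_n * 'rV[R]_m) : R :=
  g z + \sum_(i < s) w.1 0 i * gs i z + \sum_(j < r) w.2 0 j * hs j z.

Definition dual_fun g gs hs (w : 'rV[R]_s * 'rV[R]_r) : \bar R :=
  ereal_inf (range (fun z => (lagrangian g gs hs w z)%:E)).

Definition gradient_comb g gs hs (w : 'rV[R]_s * 'rV[R]_r)
    (z : 'rV[R]_n * 'rV[R]_m) : 'rV[R]_n * 'rV[R]_m :=
  gradient g z + \sum_(i < s) w.1 0 i *: gradient (gs i) z
    + \sum_(j < r) w.2 0 j *: gradient (hs j) z.

Definition dual_dom : set ('rV[R]_s * 'rV[R]_r) :=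
  [set w | nonneg_orthant w.1].

Definition dual_dom_plus : set ('rV[R]_s * 'rV[R]_r) :=
  [set w | nonneg_orthant w.1 /\ nonneg_orthant w.2].

Definition optimal_CNP g gs hs : set ('rV[R]_n * 'rV[R]_m) :=
  optimal_min g (feasible gs hs).

Definition optimal_DCNP g gs hs : set ('rV[R]_s * 'rV[R]_r) :=
  optimal_max (dual_fun g gs hs) dual_dom.

Definition optimal_PDCNP g gs hs : set ('rV[R]_s * 'rV[R]_r) :=
  optimal_max (dual_fun g gs hs) dual_dom_plus.

End ConvertibleFunction.

(* Main.v *)
Require Import Defs.
From HB Require Import structures.
From mathcomp Require Import all_boot all_order all_algebra.
From mathcomp Require Import all_classical all_reals all_analysis.
From mathcomp Require Import lra.

(** Write [L w] for the Lagrangian with multipliers [w = (u, v)]. Two independent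
    mechanisms give the theorem.

    Duality. The dual function at [w] is the infimum of [L w] over the whole
    space, so [L w z] equals it exactly when [z] is a global minimizer of [L w]
    ([dual_fun_attainedP]). At a feasible [z], with [u >= 0], the terms of the
    equality constraints vanish and those of the inequality constraints are
    nonpositive; thus the dual value at [w], [L w z] and [g z] are increasing in
    this order ([weak_duality]). If the two ends coincide, so does the middle
    term: [z] minimizes [L w], and the nonpositive terms [u_i * g_i z], whose sum
    is zero, are all zero ([duality_attainedP]). The same chain at other feasible
    points and other multipliers shows that both ends are then optimal
    ([no_gap_optimal]).

    Calculus. A differentiable function has zero gradient at a global minimum.
    The converse holds for convex functions, because a convex function lies
    above its tangents ([convex_derive_le]); and [L w] is convex as soon as
    all the multipliers are nonnegative ([convex_lagrangian]). Hence for
    nonnegative multipliers a zero gradient is equivalent to the attainment of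
    the dual value ([gradient_eq0_attainedP]), while for multipliers of equality
    constraints of arbitrary sign only the necessary direction remains
    ([gradient_eq0_of_attained]).

    The gradient of [L w] is the corresponding combination of the gradients by
    the linearity of directional derivatives ([gradient_lagrangian]). *)

Set Implicit Arguments.
Unset Strict Implicit.
Unset Printing Implicit Defensive.

Import Order.TTheory GRing.Theory Num.Theory.
Import numFieldNormedType.Exports.

Local Open Scope classical_set_scope.
Local Open Scope ring_scope.

(** * Directional derivatives at minima and along segments *)

Section DirectionalDerivative.
Context {R : realType} {V : normedModType R}.
Implicit Types (F : V -> R) (z v : V).

Lemma right_derivative F z v : derivable F z v ->
  h^-1 * (F (h *: v + z) - F z) @[h --> (0 : R)^'+] --> 'D_v F z.
Proof. by move=> dF; apply: cvg_dnbhs_at_right; exact: dF. Qed.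

(** At a global minimum every right difference quotient is nonnegative. *)
Lemma derive_ge0_at_min F z v : (forall y, F z <= F y) -> derivable F z v ->
  0 <= 'D_v F z.
Proof.
move=> Fmin /right_derivative Fv; rewrite -(cvg_lim _ Fv)//.
apply: limr_ge; first by apply/cvg_ex; eexists; exact: Fv.
near=> h; rewrite mulr_ge0 ?subr_ge0// invr_ge0 ltW//.
Unshelve. all: by end_near. Qed.

(** Differentiability makes the derivative linear in the direction, so the
    one-sided bound along [v] and along [- v] forces equality. *)
Lemma derive_eq0_at_min F z v : (forall y, F z <= F y) -> differentiable F z ->
  'D_v F z = 0.
Proof.
move=> Fmin dF; apply/eqP; rewrite eq_le derive_ge0_at_min ?andbT//; last first.
  exact: diff_derivable.
have /(derive_ge0_at_min Fmin) : derivable F z (- v) by exact: diff_derivable.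
by rewrite !deriveE// linearN oppr_ge0.
Qed.

(** Unfolds the convex-space operations into ring operations, with a plain
    real parameter in place of a bundled element of the unit interval. *)
Lemma convex_function_le F : convex_function [set: V] F ->
  forall (t : R) x y, 0 <= t <= 1 ->
    F (t *: x + (1 - t) *: y) <= t * F x + (1 - t) * F y.
Proof.
move=> cF t x y /andP[t0 t1].
by have /= := cF (Itv01 t0 t1) x y (in_setT _) (in_setT _); rewrite convRE.
Qed.

(** The first-order inequality of a convex function: on the segment from [z]
    to [y], difference quotients at [z] with step [h <= 1] lie below the slope
    [F y - F z] of the whole segment, and this bound survives [h --> 0^'+]. *)
Lemma convex_derive_le F z y : convex_function [set: V] F ->
  derivable F z (y - z) -> 'D_(y - z) F z <= F y - F z.
Proof.
move=> /convex_function_le cF /right_derivative Fv; rewrite -(cvg_lim _ Fv)//.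
apply: limr_le; first by apply/cvg_ex; eexists; exact: Fv.
near=> h.
have h0 : 0 < h by near: h; exact: nbhs_right_gt.
have h1 : h <= 1 by near: h; exact: nbhs_right_le.
rewrite ler_pdivrMl//.
have -> : h *: (y - z) + z = h *: y + (1 - h) *: z.
  by rewrite scalerBr scalerBl scale1r -addrA [- _ + z]addrC.
by have := cF h y z; rewrite h1 ltW// => /(_ isT); lra.
Unshelve. all: by end_near. Qed.

End DirectionalDerivative.

(** * Gradients on a product space *)

Section Gradient.
Context {R : realType} {n m : nat}.
Local Notation E := ('rV[R]_n * 'rV[R]_m)%type.

(** A gradient only records partial derivatives; the differential, being
    linear, is determined by them on the canonical basis of the product space. *)
Lemma gradient_eq0P (F : E -> R) z : differentiable F z ->
  gradient F z = 0 <-> forall v, 'D_v F z = 0.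
Proof.
move=> dF; split=> [[/rowP gx /rowP gy] [x y]|D0]; last first.
  by congr pair; apply/rowP => i; rewrite !mxE D0.
have -> : (x, y) = \sum_i x 0 i *: ((delta_mx 0 i, 0) : E) +
                   \sum_j y 0 j *: ((0, delta_mx 0 j) : E).
  apply/pair_equal_spec; split=> /=.
    rewrite !(raddf_sum fst) /= [X in _ + X]big1 ?addr0 => [|j _].
      exact: row_sum_delta.
    exact: scaler0.
  rewrite !(raddf_sum snd) /= big1 ?add0r => [|i _]; last exact: scaler0.
  exact: row_sum_delta.
rewrite deriveE// linearD !linear_sum !big1 ?addr0// => i _.
  by have := gy i; rewrite !mxE deriveE// linearZ => ->; exact: mulr0.
by have := gx i; rewrite !mxE deriveE// linearZ => ->; exact: mulr0.
Qed.
End Gradient.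

(** * Lagrangian duality *)

Section Lagrangian.
Context {R : realType} {n m s r : nat}.
Local Notation E := ('rV[R]_n * 'rV[R]_m)%type.
Context (g : E -> R) (gs : 'I_s -> E -> R) (hs : 'I_r -> E -> R).
Implicit Types (z : E) (w : 'rV[R]_s * 'rV[R]_r).

(** The Lagrangian as a combination in the function space, the form in which
    the rules of differential calculus apply. *)
Lemma lagrangianE w :
  lagrangian g gs hs w = g + \sum_(i < s) w.1 0 i *: (gs i : E -> R^o) +
    \sum_(j < r) w.2 0 j *: (hs j : E -> R^o).
Proof. by apply/funext => z; rewrite !fctE /lagrangian !fct_sumE. Qed.

Lemma dual_fun_le w z : (dual_fun g gs hs w <= (lagrangian g gs hs w z)%:E)%E.
Proof. by apply: ereal_inf_lbound; exists z. Qed.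

(** The dual value is an infimum over the whole space, so a point realizing
    it is exactly an unconstrained global minimizer of the Lagrangian. *)
Lemma dual_fun_attainedP w z :
  (lagrangian g gs hs w z)%:E = dual_fun g gs hs w <->
  forall z', lagrangian g gs hs w z <= lagrangian g gs hs w z'.
Proof.
split=> [Lz z'|Lmin]; first by rewrite -lee_fin Lz dual_fun_le.
apply/eqP; rewrite eq_le dual_fun_le andbT.
by apply: le_ereal_inf_tmp => _ [z' _ <-]; rewrite lee_fin.
Qed.

Lemma lagrangian_feasible w z : feasible gs hs z ->
  lagrangian g gs hs w z = g z + \sum_(i < s) w.1 0 i * gs i z.
Proof.
move=> [_ hz]; rewrite /lagrangian [X in _ + X]big1 ?addr0// => j _.
by rewrite hz mulr0.
Qed.

Lemma slack_le0 w z i : feasible gs hs z -> dual_dom w -> w.1 0 i * gs i z <= 0.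
Proof. by move=> [gz _] w0; rewrite mulr_ge0_le0. Qed.

(** At a feasible point the equality terms vanish and the inequality terms are
    nonpositive. *)
Lemma weak_duality w z : feasible gs hs z -> dual_dom w ->
  lagrangian g gs hs w z <= g z.
Proof.
move=> fz w0; rewrite lagrangian_feasible// gerDl sumr_le0// => i _.
exact: slack_le0.
Qed.

Lemma dual_fun_le_feasible w z : feasible gs hs z -> dual_dom w ->
  (dual_fun g gs hs w <= (g z)%:E)%E.
Proof.
by move=> fz w0; rewrite (le_trans (dual_fun_le w z))// lee_fin weak_duality.
Qed.

(** The gap [g z - lagrangian g gs hs w z] is a sum of nonnegative terms, so it
    vanishes only termwise. *)
Lemma complementary_slackness w z : feasible gs hs z -> dual_dom w ->
  (forall i, w.1 0 i * gs i z = 0) <-> lagrangian g gs hs w z = g z.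
Proof.
move=> fz w0; rewrite lagrangian_feasible//; split=> [s0|/eqP].
  by rewrite big1 ?addr0.
rewrite -subr_eq0 addrAC subrr add0r -oppr_eq0 -sumrN => /eqP S0 i.
apply/eqP; rewrite -oppr_eq0; apply/eqP; apply: (psumr_eq0P _ S0) => // k _.
by rewrite oppr_ge0 slack_le0.
Qed.

(** A primal value equal to a dual value collapses the chain
    [dual_fun w <= lagrangian w z <= g z]: its two inequalities become the
    attainment of the infimum and complementary slackness. *)
Lemma duality_attainedP w z : feasible gs hs z -> dual_dom w ->
  (g z)%:E = dual_fun g gs hs w <->
  (lagrangian g gs hs w z)%:E = dual_fun g gs hs w /\
  (forall i, w.1 0 i * gs i z = 0).
Proof.
move=> fz w0; rewrite complementary_slackness//.
split=> [gz|[Lz <-//]].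
have Lg : lagrangian g gs hs w z = g z.
  by apply/eqP; rewrite eq_le weak_duality//= -lee_fin gz dual_fun_le.
by rewrite Lg.
Qed.

(** Every feasible value bounds every dual value from above, so a coinciding
    pair is optimal on both sides. The multiplier domain [D] is left free in order
    to cover multipliers of equality constraints of arbitrary and of
    nonnegative sign at once. *)
Lemma no_gap_optimal (D : set ('rV[R]_s * 'rV[R]_r)) w z :
  D `<=` dual_dom -> feasible gs hs z -> D w ->
  (g z)%:E = dual_fun g gs hs w ->
  optimal_CNP g gs hs z /\ optimal_max (dual_fun g gs hs) D w.
Proof.
move=> D0 fz Dw gz; split.
  split=> // z' fz'.
  by rewrite -lee_fin gz dual_fun_le_feasible//; exact: D0.
split=> // w' Dw'.
by rewrite -gz dual_fun_le_feasible//; exact: D0.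
Qed.

Hypotheses (dg : forall z, differentiable g z)
  (dgs : forall i z, differentiable (gs i) z)
  (dhs : forall j z, differentiable (hs j) z).

Lemma differentiable_lagrangian w z : differentiable (lagrangian g gs hs w) z.
Proof.
rewrite lagrangianE; apply: differentiableD; first apply: differentiableD => //.
  by apply: differentiable_sum => i; exact: differentiableZ.
by apply: differentiable_sum => j; exact: differentiableZ.
Qed.

Lemma derive_lagrangian w z v : 'D_v (lagrangian g gs hs w) z =
  'D_v g z + \sum_(i < s) w.1 0 i * 'D_v (gs i) z +
  \sum_(j < r) w.2 0 j * 'D_v (hs j) z.
Proof.
have dgz : derivable g z v by exact: diff_derivable.
have dgsz i : derivable (w.1 0 i *: (gs i : E -> R^o)) z v.
  by apply: derivableZ; exact: diff_derivable.
have dhsz j : derivable (w.2 0 j *: (hs j : E -> R^o)) z v.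
  by apply: derivableZ; exact: diff_derivable.
have dG := derivable_sum dgsz.
have dH := derivable_sum dhsz.
rewrite lagrangianE (deriveD (derivableD dgz dG) dH) (deriveD dgz dG).
rewrite (derive_sum dgsz) (derive_sum dhsz); congr (_ + _ + _).
  by apply: eq_bigr => i _; apply: deriveZ; exact: diff_derivable.
by apply: eq_bigr => j _; apply: deriveZ; exact: diff_derivable.
Qed.

Lemma gradient_lagrangian w z :
  gradient (lagrangian g gs hs w) z = gradient_comb g gs hs w z.
Proof.
apply/pair_equal_spec; split; apply/rowP => k; rewrite !mxE derive_lagrangian.
  rewrite !(raddf_sum fst) !summxE; congr (_ + _ + _);
  by apply: eq_bigr => i _; rewrite !mxE.
rewrite !(raddf_sum snd) !summxE; congr (_ + _ + _);
by apply: eq_bigr => i _; rewrite !mxE.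
Qed.

(** Fermat's rule for the Lagrangian, which is differentiable whatever the signs
    of its multipliers. *)
Lemma gradient_eq0_of_attained w z :
  (lagrangian g gs hs w z)%:E = dual_fun g gs hs w ->
  gradient (lagrangian g gs hs w) z = 0.
Proof.
move=> /dual_fun_attainedP Lmin; apply/gradient_eq0P.
  exact: differentiable_lagrangian.
by move=> v; apply: derive_eq0_at_min => //; exact: differentiable_lagrangian.
Qed.

Hypotheses (cg : convex_function [set: E] g)
  (cgs : forall i, convex_function [set: E] (gs i))
  (chs : forall j, convex_function [set: E] (hs j)).

(** The equality constraints are convex but not necessarily affine, which is
    why their multipliers must be nonnegative too. *)
Lemma convex_lagrangian w : dual_dom_plus w ->
  convex_function [set: E] (lagrangian g gs hs w).
Proof.
move=> [u0 v0] t x y xT yT; rewrite convRE /lagrangian !mulrDr.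
rewrite !mulr_sumr [leRHS]addrACA [X in _ <= X + _]addrACA -!big_split /=.
apply: lerD; first apply: lerD.
- by have := cg t xT yT; rewrite convRE.
- apply: ler_sum => i _; rewrite !(mulrCA _ (w.1 0 i)) -mulrDr ler_wpM2l//.
  by have := cgs i t xT yT; rewrite convRE.
- apply: ler_sum => i _; rewrite !(mulrCA _ (w.2 0 i)) -mulrDr ler_wpM2l//.
  by have := chs i t xT yT; rewrite convRE.
Qed.

(** For a convex function stationarity is sufficient for a global minimum:
    [convex_derive_le] bounds every increment below by a directional derivative,
    which is zero. *)
Lemma gradient_eq0_attainedP w z : dual_dom_plus w ->
  gradient (lagrangian g gs hs w) z = 0 <->
  (lagrangian g gs hs w z)%:E = dual_fun g gs hs w.
Proof.
move=> w0; split=> [/gradient_eq0P D0|]; last exact: gradient_eq0_of_attained.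
have dL : differentiable (lagrangian g gs hs w) z.
  exact: differentiable_lagrangian.
apply/dual_fun_attainedP => z'; rewrite -subr_ge0 -(D0 dL (z' - z)).
by apply: convex_derive_le; [exact: convex_lagrangian|exact: diff_derivable].
Qed.

End Lagrangian.

(** * The optimality conditions *)

Theorem theorem7 (R : realType) (n m s r : nat)
    (f : 'rV[R]_n -> R) (g : 'rV[R]_n * 'rV[R]_m -> R)
    (gs : 'I_s -> 'rV[R]_n * 'rV[R]_m -> R)
    (hs : 'I_r -> 'rV[R]_n * 'rV[R]_m -> R)
    (hf : differentiable_convertible f g gs hs) :
  [/\
    (* (i) *)
    forall (z : 'rV[R]_n * 'rV[R]_m) (w : 'rV[R]_s * 'rV[R]_r),
      dual_dom w ->
      (lagrangian g gs hs w z)%:E = dual_fun g gs hs w ->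
      gradient (lagrangian g gs hs w) z = gradient_comb g gs hs w z /\
      gradient_comb g gs hs w z = 0,
    (* (ii) *)
    forall (z : 'rV[R]_n * 'rV[R]_m) (w : 'rV[R]_s * 'rV[R]_r),
      feasible_tight f g gs hs z -> dual_dom w ->
      (g z)%:E = dual_fun g gs hs w ->
      [/\ gradient (lagrangian g gs hs w) z = 0,
          forall i, w.1 0 i * gs i z = 0,
          optimal_CNP g gs hs z &
          optimal_DCNP g gs hs w],
    (* (iii) *)
    forall (z : 'rV[R]_n * 'rV[R]_m) (w : 'rV[R]_s * 'rV[R]_r),
      dual_dom_plus w ->
      (gradient (lagrangian g gs hs w) z = gradient_comb g gs hs w z /\
       gradient_comb g gs hs w z = 0) <->
      (lagrangian g gs hs w z)%:E = dual_fun g gs hs w &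
    (* (iv) *)
    forall (z : 'rV[R]_n * 'rV[R]_m) (w : 'rV[R]_s * 'rV[R]_r),
      feasible gs hs z -> dual_dom_plus w ->
      ((gradient (lagrangian g gs hs w) z = 0 /\
        forall i, w.1 0 i * gs i z = 0) <->
       (g z)%:E = dual_fun g gs hs w) /\
      ((g z)%:E = dual_fun g gs hs w ->
       optimal_CNP g gs hs z /\ optimal_PDCNP g gs hs w)].
Proof.
have [[_ cg cgs chs _ _] _ dg dgs dhs] := hf.
have gradL := gradient_lagrangian dg dgs dhs.
have grad0 := gradient_eq0_of_attained dg dgs dhs.
have grad0P := gradient_eq0_attainedP dg dgs dhs cg cgs chs.
split=> [z w _ Lz|z w [fz _] w0 gz|z w w0|z w fz w0].
- by split=> //; rewrite -gradL; exact: grad0.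
- have [Lz slack] := (duality_attainedP g fz w0).1 gz.
  have [] : optimal_CNP g gs hs z /\ optimal_DCNP g gs hs w.
    exact: no_gap_optimal.
  by split=> //; exact: grad0.
- rewrite -grad0P//; split=> [[-> //]|L0].
  by rewrite -gradL.
- split; first by rewrite duality_attainedP ?grad0P//; case: w0.
  by apply: no_gap_optimal => // w' [].
Qed.
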